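(* Let $M=\varprojlim M_i$ be a projective limit of Banach manifolds. The limit $\zeta=\varprojlim\zeta_i$ of a projective system of sprays $\zeta_i$ on $M_i$ is a spray on $M=\varprojlim M_i$.
   Context: Setting. $\{(M_i,\varphi_{ji})\}$ is a projective system of smooth Banach manifolds (with smooth connecting maps $\varphi_{ji}:M_j\to M_i$ for $j\ge i$), where $M_i$ is modelled on the Banach space $\mathbb E_i$ and $\{\mathbb E_i,\rho_{ji}\}$ is a projective system of Banach spaces with continuous linear maps $\rho_{ji}:\mathbb E_j\to\mathbb E_i$ and limit the Fréchet space $\mathbb F=\varprojlim\mathbb E_i$. Every $m=(m_i)\in M=\varprojlim M_i$ is assumed to have a projective system of charts $(U_i,\varphi_i)$ of $M_i$, $m_i\in U_i$, $\varphi_{ji}(U_j)\subseteq U_i$, $\varphi_i\circ\varphi_{ji}=\rho_{ji}\circ\varphi_j$ on $U_j$, such that $U=\varprojlim U_i$ is open in $M$ and $\varphi=\varprojlim\varphi_i$ maps $U$ onto an open subset of $\mathbb F$. Such $(U,\varphi)$ are the (projective limit) charts, which make $M$ a Fréchet manifold modelled on $\mathbb F$, and $TM=\varprojlim TM_i$. $L^2_s(\mathbb E,\mathbb E)$ is the space of continuous symmetric bilinear maps $\mathbb E\times\mathbb E\to\mathbb E$; $\mathcal H^2(\mathbb F,\mathbb F)$ is the Fréchet space of sequences $(B_i)$ of continuous bilinear maps $B_i:\mathbb E_i\times\mathbb E_i\to\mathbb E_i$ with $B_i\circ(\rho_{ji}\times\rho_{ji})=\rho_{ji}\circ B_j$ for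 $j\ge i$. Sprays. A spray $\zeta$ on a Banach manifold $N$ modelled on $\mathbb E$ is a second order vector field (a vector field $TN\to TTN$) such that in every chart $(U,\varphi)$ it is determined by a smooth map $\Gamma_\varphi:\varphi(U)\to L^2_s(\mathbb E,\mathbb E)$ via the principal part $[\zeta(v)]_\varphi(\varphi(m),v_\varphi)=(v_\varphi,\Gamma_\varphi(\varphi(m))(v_\varphi,v_\varphi))$, for $m\in U$, $v\in T_mN$ with local representative $v_\varphi$. A spray on $M=\varprojlim M_i$ is a second order vector field given in projective limit charts by the same formula with smooth $\Gamma_\varphi=\varprojlim\Gamma_{\varphi_i}:\varphi(U)\to\mathcal H^2(\mathbb F,\mathbb F)$ having symmetric values. Sprays $\zeta_i$ on $M_i$ form a projective system if in projective limit charts $\rho_{ji}\circ\Gamma_{\varphi_j}(u_j)=\Gamma_{\varphi_i}(\rho_{ji}u_j)\circ(\rho_{ji}\times\rho_{ji})$ for $j\ge i$; the limit is $\zeta(v)=(\zeta_i(v_i))_i$ for $v=(v_i)\in TM$. *)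

(* Defs.v *)
From HB Require Import structures.
From mathcomp Require Import all_boot all_order all_algebra.
From mathcomp Require Import all_classical all_reals all_analysis.

Set Implicit Arguments.
Unset Strict Implicit.
Unset Printing Implicit Defensive.
Import Order.TTheory GRing.Theory Num.Theory.
Import numFieldNormedType.Exports.
Local Open Scope classical_set_scope.
Local Open Scope ring_scope.

(** Products of locally convex spaces and their submodules, with the product
    and the induced topology. *)
Section prod_tvs.
Context {I : eqType} {R : realType} (T : I -> tvsType R).
Local Notation P := (prod_topology T).
Implicit Types x y z : P.

Let zero : P := fun i => 0.
Let opp x : P := fun i => - x i.
Let add x y : P := fun i => x i + y i.
Let scale (a : R) x : P := fun i => a *: x i.
Let ext x y : (forall i, x i = y i) -> x = y.
Proof. exact: functional_extensionality_dep. Qed.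

Let addA : associative add.
Proof. by move=> x y z; apply: ext => i; exact: addrA. Qed.
Let addC : commutative add.
Proof. by move=> x y; apply: ext => i; exact: addrC. Qed.
Let add0 : left_id zero add.
Proof. by move=> x; apply: ext => i; exact: add0r. Qed.
Let addN : left_inverse zero opp add.
Proof. by move=> x; apply: ext => i; exact: addNr. Qed.

HB.instance Definition _ := GRing.isZmodule.Build P addA addC add0 addN.

Let scaleA a b x : scale a (scale b x) = scale (a * b) x.
Proof. by apply: ext => i; exact: scalerA. Qed.
Let scale1 : left_id 1 scale.
Proof. by move=> x; apply: ext => i; exact: scale1r. Qed.
Let scaleDr : right_distributive scale +%R.
Proof. by move=> a x y; apply: ext => i; exact: scalerDr. Qed.
Let scaleDl x : {morph scale^~ x : a b / a + b}.
Proof. by move=> a b; apply: ext => i; exact: scalerDl. Qed.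

HB.instance Definition _ :=
  GRing.Zmodule_isLmodule.Build R P scaleA scale1 scaleDr scaleDl.

Lemma prod_continuousP (S : topologicalType) (f : S -> P) :
  (forall i, continuous (fun s => f s i)) -> continuous f.
Proof.
move=> cf s; apply/cvg_sup => i.
exact: (@continuous_comp_initial _ _ _ (fun g : P => g i) f (cf i)).
Qed.

Let pc i : continuous (fun x : P => x i).
Proof. exact: (@proj_continuous I T i). Qed.

Let add_cont : continuous (fun x : P * P => x.1 + x.2).
Proof.
apply: prod_continuousP => i x.
apply: (@continuous_comp _ _ _ (fun x : P * P => (x.1 i, x.2 i))
  (fun z : T i * T i => z.1 + z.2)); last exact: add_continuous.
apply: cvg_pair => /=.
  by apply: (@continuous_comp _ _ _ fst (fun y : P => y i));
    [exact: cvg_fst|exact: pc].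
by apply: (@continuous_comp _ _ _ snd (fun y : P => y i));
  [exact: cvg_snd|exact: pc].
Qed.

Let scale_cont : continuous (fun z : R^o * P => z.1 *: z.2).
Proof.
apply: prod_continuousP => i x.
apply: (@continuous_comp _ _ _ (fun x : R^o * P => (x.1, x.2 i))
  (fun z : R^o * T i => z.1 *: z.2)); last exact: scale_continuous.
have h1 : fst @ nbhs x --> (x.1 : R^o) by exact: cvg_fst.
have h2 : (fun x : R^o * P => x.2 i) @ nbhs x --> x.2 i.
  by apply: (@continuous_comp _ _ _ snd (fun y : P => y i));
    [exact: cvg_snd|exact: pc].
exact: (cvg_pair h1 h2).
Qed.

Let loc_convex :
  exists2 B : set_system P, (forall b, b \in B -> convex_set b) & basis B.
Proof.
exists [set b | open b /\ convex_set b]; first by move=> b /[!inE] -[].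
split=> [b []//|x]; set F := filter_from _ _.
have FF : Filter F.
  apply: filter_from_filter.
    exists setT; split => //; split; first exact: openT.
    by move=> ? ? ? _ _; rewrite inE.
  move=> a b [[oa ca] ax] [[ob cb] bx]; exists (a `&` b) => //.
  split=> //; split; first exact: openI.
  move=> u v l /set_mem[au bu] /set_mem[av bv]; apply/mem_set; split.
    by apply/set_mem/ca; exact/mem_set.
  by apply/set_mem/cb; exact/mem_set.
apply/cvg_sup => i A [_ [[W oW <-] /= Wx WA]].
have [B Bc [Bo Bb]] := @locally_convex R (T i).
have [b /= [Bib bx] bW] := Bb (x i) W (open_nbhs_nbhs (conj oW Wx)).
exists ((fun y : P => y i) @^-1` b); last by move=> y /bW /WA.
split=> //; split; 
  first by have /continuousP h := @pc i; have hb := h b (Bo _ Bib); refine hb.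
move=> u v l /set_mem/= bu /set_mem/= bv; apply/mem_set => /=.
by apply/set_mem/(Bc b (mem_set Bib) (u i) (v i) l); exact/mem_set.
Qed.

HB.instance Definition _ :=
  PreTopologicalNmodule_isTopologicalNmodule.Build P add_cont.
HB.instance Definition _ :=
  TopologicalNmodule_isTopologicalLmodule.Build R P scale_cont.
HB.instance Definition _ := Uniform_isTvs.Build R P loc_convex.

End prod_tvs.


Record submodule {R : realType} (V : tvsType R) := Submodule {
  sub_set :> set V;
  sub_closed : submod_closed [pred x | x \in sub_set] }.

Section sub_tvs.
Context {R : realType} {V : tvsType R} (A : submodule V).

Definition in_sub (x : V) : bool := x \in sub_set A.

HB.instance Definition _ :=
  GRing.isSubmodClosed.Build R V in_sub (sub_closed A).

Definition subtvs : Type := {x : V | in_sub x}.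
Local Notation S := subtvs.

HB.instance Definition _ := SubChoice.on S.
HB.instance Definition _ := Uniform.copy S (initial_topology (val : S -> V)).
HB.instance Definition _ := [SubChoice_isSubLmodule of S by <:].

Let vc : continuous (val : S -> V).
Proof. exact: initial_continuous. Qed.

Let into (X : topologicalType) (f : X -> S) :
  continuous (fun x => val (f x)) -> continuous f.
Proof. exact: (@continuous_comp_initial _ _ _ (val : S -> V) f). Qed.

Let add_cont : continuous (fun x : S * S => x.1 + x.2).
Proof.
apply: into => x /=.
apply: (@continuous_comp _ _ _ (fun x : S * S => (val x.1, val x.2))
  (fun z : V * V => z.1 + z.2)); last exact: add_continuous.
apply: cvg_pair => /=.
  by apply: (@continuous_comp _ _ _ fst (val : S -> V));
    [exact: cvg_fst|exact: vc].
by apply: (@continuous_comp _ _ _ snd (val : S -> V));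
  [exact: cvg_snd|exact: vc].
Qed.

Let scale_cont : continuous (fun z : R^o * S => z.1 *: z.2).
Proof.
apply: into => x /=.
apply: (@continuous_comp _ _ _ (fun x : R^o * S => (x.1, val x.2))
  (fun z : R^o * V => z.1 *: z.2)); last exact: scale_continuous.
have h1 : fst @ nbhs x --> (x.1 : R^o) by exact: cvg_fst.
have h2 : (fun x : R^o * S => val x.2) @ nbhs x --> val x.2.
  by apply: (@continuous_comp _ _ _ snd (val : S -> V));
    [exact: cvg_snd|exact: vc].
exact: (cvg_pair h1 h2).
Qed.

Let loc_convex :
  exists2 B : set_system S, (forall b, b \in B -> convex_set b) & basis B.
Proof.
have [B Bc [Bo Bb]] := @locally_convex R V.
exists [set b | exists2 c, B c & b = val @^-1` c].
  move=> _ /set_mem[c Bcc ->] u v l /set_mem/= cu /set_mem/= cv.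
  apply/mem_set => /=.
  by apply/set_mem/(Bc c (mem_set Bcc) (val u) (val v) l); exact/mem_set.
split.
  move=> b [c Bcc ->].
  by have /continuousP h := vc; have hc := h c (Bo _ Bcc); refine hc.
move=> x W [b [bo bx bW]].
case: bo bx bW => O oO <- /= Ox OW.
have [c /= [Bcc cx] cO] := Bb (val x) O (open_nbhs_nbhs (conj oO Ox)).
by exists (val @^-1` c) => [/=|y /cO /OW //]; split=> //; exists c.
Qed.

HB.instance Definition _ :=
  PreTopologicalNmodule_isTopologicalNmodule.Build S add_cont.
HB.instance Definition _ :=
  TopologicalNmodule_isTopologicalLmodule.Build R S scale_cont.
HB.instance Definition _ := Uniform_isTvs.Build R S loc_convex.
End sub_tvs.

(** Smooth maps between topological vector spaces, in the sense of Michal and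
    Bastiani (also called Keller C^oo_c, or Hamilton's notion): all iterated
    directional derivatives exist and are jointly continuous. Between Banach
    spaces this is the usual Frechet C^oo; it also makes sense on Frechet
    spaces, so that one notion serves both for the factors and the limit. *)
Section smooth.
Context {R : realType}.

Definition is_dderiv {V W : tvsType R} (f : V -> W) (x v : V)
    (w : W) : Prop :=
  (fun h : R => h^-1 *: (f (x + h *: v) - f x)) @ 0^' --> w.

Fixpoint Ck (k : nat) {V W : tvsType R} (U : set V)
    (f : V -> W) : Prop :=
  {in U, continuous f} /\
  if k is k'.+1 then
    exists df : V * V -> W,
      (forall x v, U x -> is_dderiv f x v (df (x, v))) /\
      Ck k' (U `*` setT) df
  else True.

Definition smooth_on {V W : tvsType R} (U : set V)
    (f : V -> W) : Prop :=
  open U /\ forall k, Ck k U f.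

End smooth.

(** A chart (dom c, c) is a partial map: only the values of [c] on [dom c] are
    meaningful. *)
Record chart (X V : Type) := Chart { dom : set X; cmap :> X -> V }.

(** A set with a family of charts. Being a manifold is the separate predicate
    [is_manifold]; the tangent bundle and the projective limit are
    constructions on this raw structure. *)
Record premanifold {R : realType} (V : tvsType R) :=
  Premanifold { point_of :> Type; atlas : set (chart point_of V) }.

HB.instance Definition _ {R : realType} {V : tvsType R}
  (N : premanifold V) := gen_eqMixin (point_of N).
HB.instance Definition _ {R : realType} {V : tvsType R}
  (N : premanifold V) := gen_choiceMixin (point_of N).
(* The manifold topology, generated by the sets c^-1(O), O open in V. *)
HB.instance Definition _ {R : realType} {V : tvsType R}
    (N : premanifold V) :=
  isSubBaseTopological.Build (point_of N)
    [set A : set N | exists c O,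
       [/\ atlas c, open O & A = dom c `&` c @^-1` O]] idfun.

Section manifolds.
Context {R : realType}.
Implicit Types V W : tvsType R.

(* d \o f \o c^-1; the point [m] of [dom c] is the default value of the
   inverse of c outside the image of [dom c]. *)
Definition local_rep {V W} {N : premanifold V} {P : premanifold W}
    (c : chart N V) (d : chart P W) (f : N -> P) (m : N) : V -> W :=
  d \o f \o 'pinv_(fun=> m) (dom c) c.

Definition compatible {V} {N : premanifold V} (c d : chart N V) : Prop :=
  open (c @` (dom c `&` dom d)) /\
  forall m, (dom c `&` dom d) m ->
    smooth_on (c @` (dom c `&` dom d)) (local_rep c d idfun m).

Definition is_chart {V} {N : premanifold V} (c : chart N V) : Prop :=
  {in dom c &, injective c} /\ open (c @` dom c).

(* The atlas is maximal, so that "every chart of N" means "every c in the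
   atlas". *)
Definition is_manifold {V} (N : premanifold V) : Prop :=
  [/\ forall c, atlas (p := N) c -> is_chart c,
      forall m : N, exists2 c, atlas c & dom c m,
      forall c d, atlas (p := N) c -> atlas d -> compatible c d &
      forall c : chart N V, is_chart c ->
        (forall d, atlas d -> compatible c d /\ compatible d c) -> atlas c].

Definition smooth_map {V W} {N : premanifold V} {P : premanifold W}
    (f : N -> P) : Prop :=
  forall m : N, exists c d,
    [/\ atlas c, atlas d, dom c m, f @` dom c `<=` dom d &
        smooth_on (c @` dom c) (local_rep c d f m)].

(** A tangent vector at [base], given by its local representatives in all the
    charts at [base], related by the derivatives of the transition maps;
    [rep_off] normalizes the meaningless values, so that equality is the right
    one. *)
Record tangent {V} (N : premanifold V) := Tangent {
  base : N;
  rep : chart N V -> V;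
  rep_off : forall c, ~ (atlas c /\ dom c base) -> rep c = 0;
  rep_coh : forall c d, atlas c -> dom c base -> atlas d -> dom d base ->
    is_dderiv (local_rep c d idfun base) (c base) (rep c) (rep d) }.

HB.instance Definition _ {V} (N : premanifold V) := gen_eqMixin (tangent N).
HB.instance Definition _ {V} (N : premanifold V) := gen_choiceMixin (tangent N).

Definition tchart {V} {N : premanifold V} (c : chart N V) :
    chart (tangent N) (V * V)%type :=
  Chart (@base V N @^-1` dom c) (fun v => (c (base v), rep v c)).

Definition tbundle {V} (N : premanifold V) : premanifold (V * V)%type :=
  @Premanifold R (V * V)%type (tangent N) (@tchart V N @` atlas (p := N)).

Lemma is_dderiv0 {V W} (f : V -> W) (x : V) : is_dderiv f x 0 0.
Proof.
rewrite /is_dderiv; under eq_fun do rewrite scaler0 addr0 subrr scaler0.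
exact: cvg_cst.
Qed.

Definition zero_tangent {V} (N : premanifold V) (m : N) : tangent N :=
  @Tangent V N m (fun=> 0) (fun _ _ => erefl)
    (fun c d _ _ _ _ => is_dderiv0 _ _).

Definition is_tmap {V W} {N : premanifold V} {P : premanifold W} (f : N -> P)
    (v : tangent N) (w : tangent P) : Prop :=
  base w = f (base v) /\
  forall c d, atlas c -> dom c (base v) -> atlas d -> dom d (base w) ->
    is_dderiv (local_rep c d f (base v)) (c (base v)) (rep v c) (rep w d).

(* The default value is never taken when f is a smooth map of manifolds. *)
Definition tmap {V W} {N : premanifold V} {P : premanifold W} (f : N -> P)
    (v : tbundle N) : tbundle P :=
  xget (zero_tangent (f (base v))) [set w | is_tmap f v w].

Definition vector_field {V} {N : premanifold V} (X : N -> tbundle N) : Prop :=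
  smooth_map X /\ forall m, base (X m) = m.

Definition second_order {V} {N : premanifold V}
    (zeta : tbundle N -> tbundle (tbundle N)) : Prop :=
  vector_field zeta /\
  forall v, tmap (@base V N : tbundle N -> N) (zeta v) = v.

End manifolds.


(** Continuous bilinear maps, with the operator norm; |(x, y)| is the maximum
    of |x| and |y|. *)
Section bilinear_maps.
Context {R : realType} (V : normedModType R).

Definition continuous_bilinear (B : V * V -> V) : Prop :=
  [/\ forall x, linear (fun y => B (x, y)),
      forall y, linear (fun x => B (x, y)) & continuous B].

Definition is_L2 (B : V * V -> V) : bool := `[< continuous_bilinear B >].

Lemma is_L2_closed : submod_closed is_L2.
Proof.
split=> [|a B C /asboolP[Br Bl Bc] /asboolP[Cr Cl Cc]]; apply/asboolP; split.
- by move=> x a u v /=; rewrite scaler0 addr0.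
- by move=> x a u v /=; rewrite scaler0 addr0.
- by move=> x; exact: cvg_cst.
- move=> x b u v; change (a *: B (x, b *: u + v) + C (x, b *: u + v) =
    b *: (a *: B (x, u) + C (x, u)) + (a *: B (x, v) + C (x, v))).
  by rewrite Br Cr !scalerDr !scalerA addrACA mulrC.
- move=> x b u v; change (a *: B (b *: u + v, x) + C (b *: u + v, x) =
    b *: (a *: B (u, x) + C (u, x)) + (a *: B (v, x) + C (v, x))).
  by rewrite Bl Cl !scalerDr !scalerA addrACA mulrC.
- by move=> x; apply: cvgD; [apply: cvgZr; exact: Bc|exact: Cc].
Qed.

HB.instance Definition _ := GRing.isSubmodClosed.Build R (V * V -> V)
  is_L2 is_L2_closed.

Definition L2 : Type := {B : V * V -> V | is_L2 B}.
HB.instance Definition _ := SubChoice.on L2.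
HB.instance Definition _ := [SubChoice_isSubLmodule of L2 by <:].

Definition L2fun (B : L2) : V * V -> V := val B.
Coercion L2fun : L2 >-> Funclass.

Definition L2norm (B : L2) : R := sup [set `|B z| | z in [set z | `|z| <= 1]].

Lemma L2P (B : L2) : continuous_bilinear B.
Proof. exact/asboolP/(valP B). Qed.

Lemma L2Zl (B : L2) a x y : B (a *: x, y) = a *: B (x, y).
Proof.
have [_ /(_ y) Bl _] := L2P B.
have := Bl a x 0; rewrite addr0 => ->.
have := Bl (-1) 0 0; rewrite scaler0 addr0 scaleN1r addNr => ->.
by rewrite addr0.
Qed.

Lemma L2Zr (B : L2) a x y : B (x, a *: y) = a *: B (x, y).
Proof.
have [/(_ x) Br _ _] := L2P B.
have := Br a y 0; rewrite addr0 => ->.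
have := Br (-1) 0 0; rewrite scaler0 addr0 scaleN1r addNr => ->.
by rewrite addr0.
Qed.

Lemma L2ZZ (B : L2) a (z : V * V) : B (a *: z) = (a * a) *: B z.
Proof. by case: z => x y; rewrite L2Zl L2Zr scalerA. Qed.

Lemma L2_bounded (B : L2) :
  has_ubound [set `|B z| | z in [set z | `|z| <= 1]].
Proof.
have B0 : B 0 = 0 by rewrite -(scale0r 0) L2ZZ mul0r !scale0r.
have /(_ 0) /cvgr_dist_lt : continuous B by have [] := L2P B.
move=> /(_ 1 ltr01) /nbhs_ballP[e /= e0 Be].
exists ((e / 2) ^- 2) => _ [z /= z1 <-].
have e20 : 0 < e / 2 by rewrite divr_gt0.
have /Be : ball 0 e ((e / 2) *: z).
  rewrite -ball_normE /= sub0r normrN normrZ gtr0_norm //.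
  by rewrite (le_lt_trans (ler_piMr (ltW e20) z1)) // ltr_pdivrMr // ltr_pMr // ltr1n.
rewrite /= B0 sub0r normrN L2ZZ normrZ gtr0_norm ?mulr_gt0 // => h.
by rewrite -[leRHS]mul1r ler_pdivlMr ?exprn_gt0 // mulrC expr2 ltW.
Qed.

Lemma L2norm_ub (B : L2) z : `|z| <= 1 -> `|B z| <= L2norm B.
Proof. by move=> z1; apply: ub_le_sup; [exact: L2_bounded|exists z]. Qed.

Let ne (B : L2) : [set `|B z| | z in [set z | `|z| <= 1]] !=set0.
Proof. by exists `|B 0|, 0; rewrite /= ?normr0 ?ler01. Qed.

Lemma L2normD (B C : L2) : L2norm (B + C) <= L2norm B + L2norm C.
Proof.
apply: ge_sup => [|_ [z /= z1 <-]]; first exact: ne.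
by rewrite (le_trans (ler_normD _ _)) // lerD // L2norm_ub.
Qed.

Lemma L2normZ a (B : L2) : L2norm (a *: B) = `|a| * L2norm B.
Proof.
have le b (C : L2) : L2norm (b *: C) <= `|b| * L2norm C.
  apply: ge_sup => [|_ [z /= z1 <-]]; first exact: ne.
  by rewrite [leLHS]normrZ ler_wpM2l // L2norm_ub.
apply/eqP; rewrite eq_le le /=; have [->|a0] := eqVneq a 0.
  rewrite normr0 mul0r; apply: le_trans (L2norm_ub _ (z := 0) _) => //.
  by rewrite normr0.
rewrite mulrC -ler_pdivlMr ?normr_gt0 // mulrC -normfV.
by rewrite -[X in L2norm X <= _](scale1r B) -(mulVf a0) -scalerA.
Qed.

Lemma L2norm0_eq0 (B : L2) : L2norm B = 0 -> B = 0.
Proof.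
move=> B0; apply: val_inj; apply/funext => z /=; apply/eqP.
have [->|z0] := eqVneq z 0.
  by rewrite -[val B]/(L2fun B) -(scale0r 0) L2ZZ mul0r !scale0r.
rewrite -normr_le0; have zp : 0 < `|z| by rewrite normr_gt0.
have : `|B (`|z|^-1 *: z)| <= 0.
  by rewrite -B0 L2norm_ub // normrZ normfV normr_id mulVf // gt_eqF.
by rewrite L2ZZ normrZ pmulr_rle0 // normr_gt0 mulf_neq0 // invr_eq0 gt_eqF.
Qed.

HB.instance Definition _ :=
  @Lmodule_isNormed.Build R L2 L2norm L2normD L2normZ L2norm0_eq0.

End bilinear_maps.

(** Projective systems of manifolds indexed by nat, and their limits. *)
Definition threads {X : nat -> Type} (f : forall i j, (i <= j)%N -> X j -> X i) :
    set (prod_topology X) :=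
  [set x | forall i j (h : (i <= j)%N), f i j h (x j) = x i].

Definition functorial {X : nat -> Type}
    (f : forall i j, (i <= j)%N -> X j -> X i) : Prop :=
  (forall i (h : (i <= i)%N) x, f i i h x = x) /\
  (forall i j k (h : (i <= j)%N) (h' : (j <= k)%N) x,
     f i j h (f j k h' x) = f i k (leq_trans h h') x).

Definition prodmap {V W : Type} (f : V -> W) (z : V * V) : W * W :=
  (f z.1, f z.2).

Section prodmap_linear.
Context {R : realType} {V W : tvsType R} (f : {linear V -> W}).
Lemma prodmap_is_linear : linear (prodmap f).
Proof. by move=> a [x y] [x' y']; rewrite /prodmap /= !linearP. Qed.
HB.instance Definition _ := GRing.isLinear.Build R (V * V)%type (W * W)%type
  *:%R (prodmap f) prodmap_is_linear.
End prodmap_linear.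

Record psystem (R : realType) := PSystem {
  space : nat -> tvsType R;
  bond : forall i j, (i <= j)%N -> {linear space j -> space i};
  man : forall i, premanifold (space i);
  link : forall i j, (i <= j)%N -> man j -> man i }.

Arguments bond {R} _ {i j} h.
Arguments link {R} _ {i j} h.

Section limits.
Context {R : realType}.
Implicit Types S : psystem R.

Lemma threads_closed S :
  submod_closed [pred x | x \in threads (fun i j h => bond S h)].
Proof.
split=> [|a x y /set_mem xP /set_mem yP]; apply/mem_set => i j h.
  exact: linear0.
by rewrite [LHS]linearP xP yP.
Qed.

(* The space F = lim E_i, with the topology induced by the product. *)
Definition lim_space S : tvsType R := subtvs (Submodule (threads_closed S)).

(* M = lim M_i, with the topology induced by the product. *)
Definition lim_point S : topologicalType := set_type (threads (fun i j h => link S h)).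

Definition coord {S} (u : lim_space S) (i : nat) : space S i := val u i.
Definition proj_point {S} (m : lim_point S) (i : nat) : man S i := val m i.

(* The limit (U, phi) of charts (U_i, phi_i); phi(m) is the unique element of F
   with components phi_i(m_i) when this sequence is in F. *)
Definition lim_chart S (c : forall i, chart (man S i) (space S i)) :
    chart (lim_point S) (lim_space S) :=
  Chart [set m : lim_point S | forall i, dom (c i) (proj_point m i)]
    (fun m => xget (0 : lim_space S)
      [set u | forall i, coord u i = c i (proj_point m i)]).

Definition plim_charts S (c : forall i, chart (man S i) (space S i)) : Prop :=
  [/\ forall i, atlas (c i),
      forall i j (h : (i <= j)%N), link S h @` dom (c j) `<=` dom (c i),
      forall i j (h : (i <= j)%N) m, dom (c j) m ->
        c i (link S h m) = bond S h (c j m),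
      open (dom (lim_chart c)) &
      open (lim_chart c @` dom (lim_chart c))].

Definition plim S : premanifold (lim_space S) :=
  @Premanifold R (lim_space S) (lim_point S)
    (@lim_chart S @` @plim_charts S).

Definition tsystem S : psystem R :=
  @PSystem R (fun i => (space S i * space S i)%type)
    (fun i j h => prodmap (bond S h))
    (fun i => tbundle (man S i))
    (fun i j h => tmap (link S h)).

End limits.

(** Sprays on a Banach manifold: [rep z (tchart c)] is the principal part of
    z in T(TN) in the chart induced by [c]. *)
Section sprays.
Context {R : realType} {V : normedModType R} {N : premanifold V}.

Definition symmetric_map (B : L2 V) : Prop := forall x y, B (x, y) = B (y, x).

Definition local_spray (zeta : tbundle N -> tbundle (tbundle N))
    (c : chart N V) (Gamma : V -> L2 V) : Prop :=
  [/\ smooth_on (c @` dom c) Gamma,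
      forall u, (c @` dom c) u -> symmetric_map (Gamma u) &
      forall v, dom c (base v) ->
        rep (zeta v) (tchart c) =
          (rep v c, Gamma (c (base v)) (rep v c, rep v c))].

Definition is_spray (zeta : tbundle N -> tbundle (tbundle N)) : Prop :=
  second_order zeta /\
  forall c, atlas c -> exists Gamma, local_spray zeta c Gamma.

End sprays.

Section limit_sprays.
Context {R : realType} {E : nat -> normedModType R}.
Variables (rho : forall i j, (i <= j)%N -> {linear E j -> E i}).
Arguments rho {i j} _.

Definition H2_threads : set (prod_topology (fun i => L2 (E i))) :=
  [set B | forall i j (h : (i <= j)%N) x y,
     L2fun (B i) (rho h x, rho h y) = rho h (L2fun (B j) (x, y))].

Lemma H2_closed : submod_closed [pred B | B \in H2_threads].
Proof.
split=> [|a B C /set_mem BP /set_mem CP]; apply/mem_set => i j h x y.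
  by symmetry; exact: linear0.
change (a *: L2fun (B i) (rho h x, rho h y) + L2fun (C i) (rho h x, rho h y) =
  rho h (a *: L2fun (B j) (x, y) + L2fun (C j) (x, y))).
by rewrite linearP BP CP.
Qed.

(* H^2(F, F), with the topology induced by the product of the L^2(E_i, E_i). *)
Definition H2 : tvsType R := subtvs (Submodule H2_closed).

Definition H2coord (B : H2) (i : nat) : L2 (E i) := val B i.

Variable (M : forall i, premanifold (E i)).
Variable (phi : forall i j, (i <= j)%N -> M j -> M i).
Local Notation S := (@PSystem R E (@rho) M phi).

(* As TM = lim TM_i and TTM = lim TTM_i, a map TM -> TTM is between threads,
   and its principal part in a limit chart is read componentwise. *)
Definition local_limit_spray
    (zeta : plim (tsystem S) -> plim (tsystem (tsystem S)))
    (c : forall i, chart (M i) (E i)) (Gamma : lim_space S -> H2) : Prop :=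
  let phi_c := lim_chart (S := S) c in
  [/\ smooth_on (phi_c @` dom phi_c) Gamma,
      (exists Gamma_ : forall i, E i -> L2 (E i),
         (forall i, smooth_on (c i @` dom (c i)) (Gamma_ i)) /\
         forall u, (phi_c @` dom phi_c) u ->
           forall i, H2coord (Gamma u) i = Gamma_ i (coord u i)),
      forall u, (phi_c @` dom phi_c) u ->
        forall i, symmetric_map (H2coord (Gamma u) i) &
      forall (m : lim_point S) (v : plim (tsystem S)),
        (forall i, base (proj_point v i) = proj_point m i) -> dom phi_c m ->
        forall i, rep (proj_point (zeta v) i) (tchart (c i)) =
          (rep (proj_point v i) (c i),
           H2coord (Gamma (phi_c m)) i
             (rep (proj_point v i) (c i), rep (proj_point v i) (c i)))].

Definition is_limit_spray
    (zeta : plim (tsystem S) -> plim (tsystem (tsystem S))) : Prop :=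
  [/\ smooth_map zeta,
      forall v i, base (proj_point (zeta v) i) = proj_point v i,
      forall v i, tmap (@base R (E i) (M i) : tbundle (M i) -> M i)
        (proj_point (zeta v) i) = proj_point v i &
      forall c, plim_charts (S := S) c ->
        exists Gamma, local_limit_spray zeta c Gamma].

Definition projective_sprays
    (zeta : forall i, tbundle (M i) -> tbundle (tbundle (M i))) : Prop :=
  forall c (Gamma : forall i, E i -> L2 (E i)), plim_charts (S := S) c ->
    (forall i, local_spray (zeta i) (c i) (Gamma i)) ->
    forall i j (h : (i <= j)%N) u x y, (c j @` dom (c j)) u ->
      rho h (Gamma j u (x, y)) = Gamma i (rho h u) (rho h x, rho h y).

End limit_sprays.

(* Main.v *)
Require Import Defs.
From HB Require Import structures.
From mathcomp Require Import all_boot all_order all_algebra.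
From mathcomp Require Import all_classical all_reals all_analysis.
Import Defs.

Set Implicit Arguments.
Unset Strict Implicit.
Unset Printing Implicit Defensive.
Import Order.TTheory GRing.Theory Num.Theory.
Import numFieldNormedType.Exports.
Local Open Scope classical_set_scope.
Local Open Scope ring_scope.

(** The limit spray has components zeta_i(v_i), so three things are to be
    shown: that these components form a point of TTM = lim TTM_i, that the
    resulting map is smooth in limit charts, and that its principal part is
    given by a smooth map into H^2(F, F).

    The first point says that T(T phi_ji) maps zeta_j(v_j) to zeta_i(v_i).
    Around a point of M take a projective system of charts. There phi_ji is
    represented by the linear map rho_ji, hence T phi_ji by rho_ji x rho_ji
    and T(T phi_ji) by (rho_ji x rho_ji) x (rho_ji x rho_ji); on principal
    parts the claim is the compatibility of the maps Gamma_i. The tangent map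
    is defined by its representatives in all charts, so passing from adapted
    charts to arbitrary ones takes the chain rule for the Michal-Bastiani
    derivative ([dderiv_comp]), which rests on a mean value theorem valid in
    every locally convex space ([mean_value]). The conclusion is
    [tmap_linear_rep].

    Limit charts of M induce limit charts of TM, and by the same lemma limit
    charts of TTM ([plim_tcharts]); the hypotheses used there ([good_system])
    are inherited by the system of tangent bundles ([good_tsystem]).

    Both smoothness claims reduce to components, because the limits of the
    model spaces and H^2(F, F) are closed subspaces of products: a map into
    such a subspace is C^k if its components are ([Ck_into_subtvs]). The i-th
    component of the local representative of zeta is (x, w) |-> ((x, w), (w,
    Gamma_i(x)(w, w))) after the continuous linear projection onto E_i x E_i,
    and the Leibniz rule ([Ck_L2]) makes it smooth; the i-th component of
    Gamma is Gamma_i after the projection onto E_i. *)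

(** * A mean value theorem in locally convex spaces *)

Section mean_value.
Context {R : realType} {W : tvsType R}.

Lemma convex_comb (B : set W) (a b : R) (x y : W) :
  convex_set B -> 0 <= a -> 0 <= b -> a + b = 1 -> B x -> B y ->
  B (a *: x + b *: y).
Proof.
move=> cB a0 b0 ab Bx By.
have a1 : 0 <= a <= 1 by rewrite a0 -ab lerDl.
have := cB x y (Itv01 (proj1 (andP a1)) (proj2 (andP a1)))
  (mem_set Bx) (mem_set By).
move=> /set_mem; congr B; congr (_ + _ *: _).
by rewrite /= /unstable.onem -ab addrC addKr.
Qed.

(** The slope of g over [a, c] is a convex combination of its slopes over [a,
    b] and [b, c], so slopes in B can be glued. The supremum of the t such
    that the slope over [0, t] lies in B is then 1. Convexity of B stands in
    for a norm on W, so this serves Banach and Frechet spaces alike. *)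
Lemma mean_value (B : set W) (g : R -> W) : convex_set B ->
  (forall t, 0 <= t <= 1 ->
    \forall s \near 0^', B (s^-1 *: (g (t + s) - g t))) ->
  B (g 1 - g 0).
Proof.
move=> cB dg; pose P a b := B ((b - a)^-1 *: (g b - g a)).
(* gluing of slopes over adjacent intervals *)
have PP a b c : a < b -> b < c -> P a b -> P b c -> P a c.
  move=> ab bc Pab Pbc; have ac := lt_trans ab bc.
  have ac0 : c - a != 0 by rewrite gt_eqF// subr_gt0.
  have ab0 : b - a != 0 by rewrite gt_eqF// subr_gt0.
  have bc0 : c - b != 0 by rewrite gt_eqF// subr_gt0.
  have := convex_comb (a := (b - a) / (c - a)) (b := (c - b) / (c - a)) cB _ _ _
    Pab Pbc.
  have cancel d : d != 0 -> d / (c - a) * d^-1 = (c - a)^-1.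
    by move=> d0; rewrite mulrAC divff// mul1r.
  rewrite !scalerA !cancel// -scalerDr /P.
  rewrite (_ : g b - g a + (g c - g b) = g c - g a); last first.
    by rewrite addrC addrA subrK.
  apply.
  - by rewrite divr_ge0// subr_ge0 ltW.
  - by rewrite divr_ge0// subr_ge0 ltW.
  - by rewrite -mulrDl (addrC (b - a)) addrA subrK divff.
pose A := [set t : R | 0 <= t <= 1 /\ (t = 0 \/ P 0 t)].
have A0 : A 0 by split; [rewrite lexx ler01|left].
have supA : has_sup A by split; [exists 0|exists 1 => t [/andP[]]].
set s := sup A.
have s01 : 0 <= s <= 1.
  rewrite (ub_le_sup (proj2 supA) A0) ge_sup//; first by exists 0.
  by move=> t [/andP[]].
have [e /= e0 Be] := dg _ s01.
(* near s, the slopes over intervals with endpoint s lie in B *)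
have below a : s - e < a -> a < s -> P a s.
  move=> ea as_; have := Be (a - s).
  rewrite /= sub0r normrN ltr0_norm ?subr_lt0// opprB.
  move=> /(_ _ _); rewrite ltrBlDr -ltrBlDl => /(_ ea).
  rewrite lt_eqF ?subr_lt0// => /(_ isT).
  by rewrite (addrC s) subrK /P -(opprB s) invrN scaleNr -scalerN opprB.
have above b : s < b -> b < s + e -> P s b.
  move=> sb be; have := Be (b - s).
  rewrite /= sub0r normrN gtr0_norm ?subr_gt0//.
  move=> /(_ _ _); rewrite ltrBlDl => /(_ be).
  by rewrite gt_eqF ?subr_gt0// => /(_ isT); rewrite (addrC s) subrK.
have As : A s.
  have [a Aa sa] := sup_adherent e0 supA.
  have := ub_le_sup (proj2 supA) Aa.
  rewrite -/s le_eqVlt => /orP[/eqP <-//|as_].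
  split=> //; right; have Pas := below _ sa as_.
  case: Aa => /andP[a0 a1] [a0'|P0a]; first by rewrite -a0'.
  move: a0; rewrite le_eqVlt => /orP[/eqP a0|a0]; first by rewrite a0.
  exact: PP P0a Pas.
have s1 : s = 1.
  apply/eqP; rewrite eq_le; case/andP: (s01) => s0 ->/=; rewrite leNgt.
  apply/negP => s1; pose b := Num.min 1 (s + e / 2).
  have sb : s < b by rewrite lt_min s1 ltrDl divr_gt0.
  have be : b < s + e.
    by rewrite gt_min ltrD2l ltr_pdivrMr// ltr_pMr// ltr1n orbT.
  have Ab : A b.
    split; first by rewrite (le_trans s0 (ltW sb)) ge_min lexx.
    right; have Psb := above _ sb be.
    case: As => _ [s0'|P0s]; first by rewrite -s0'.
    move: s0; rewrite le_eqVlt => /orP[/eqP ->//|s0].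
    exact: PP P0s Psb.
  by have := ub_le_sup (proj2 supA) Ab; rewrite leNgt sb.
case: As => _ []; first by rewrite s1 => /eqP; rewrite oner_eq0.
by rewrite s1 /P subr0 invr1 scale1r.
Qed.

End mean_value.

(** * Directional derivatives *)

Section dderiv.
Context {R : realType}.
Implicit Types V W : tvsType R.

Lemma dderiv_unique V W (f : V -> W) x v w w' : hausdorff_space W ->
  is_dderiv f x v w -> is_dderiv f x v w' -> w = w'.
Proof. by move=> hW; apply: cvg_unique. Qed.

(** The increment of f along a varying direction. The mean value theorem applied
    to t |-> f (y + t h w_h) / h puts the quotient in any convex neighbourhood
    of df (y, w), because df is jointly continuous at (y, w). *)
Lemma slope_cvg V W (U : set V) (f : V -> W) df (y w : V) (w_ : R -> V) :
  open U -> (forall x v, U x -> is_dderiv f x v (df (x, v))) ->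
  {in U `*` setT, continuous df} -> U y -> w_ @ 0^' --> w ->
  (fun h : R => h^-1 *: (f (y + h *: w_ h) - f y)) @ 0^' --> df (y, w).
Proof.
move=> oU dfP cdf Uy w_w N Nw.
have [B0 B0c [B0o B0b]] := @locally_convex R W.
have [B [/= B0B Bw] BN] := B0b _ _ Nw.
have cB := B0c B (mem_set B0B).
have [[P Q] /= [Py Qw] PQ] : nbhs (y, w) (df @^-1` B).
  apply: (cdf (y, w)); first by rewrite inE.
  by apply: open_nbhs_nbhs; split=> //; exact: B0o.
have [[S Q'] /= [S0 Q'w] SQ] :
    nbhs (0 : R^o, w) ((fun z : R^o * V => y + z.1 *: z.2) @^-1` (P `&` U)).
  have c1 : (fun z : R^o * V => z.1 *: z.2) @ nbhs (0 : R^o, w) --> (0 : V).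
    by have := @scale_continuous R V (0, w); rewrite /continuous_at /= scale0r.
  have c2 : (fun z : R^o * V => (y, z.1 *: z.2)) @ nbhs (0 : R^o, w)
     --> (y, 0 : V).
    by apply: cvg_pair => //; exact: cvg_cst.
  have c3 := @add_continuous V (y, 0); rewrite /continuous_at /= addr0 in c3.
  have PU : nbhs y (P `&` U) by apply: filterI => //; exact: open_nbhs_nbhs.
  exact: (cvg_comp _ _ c2 c3 _ PU).
have [d /= d0 dS] : nbhs_ball (0 : R) S by exact/nbhs_ballP.
change (\forall h \near 0^', N (h^-1 *: (f (y + h *: w_ h) - f y))).
near=> h.
have h0 : h != 0 by near: h; exact: nbhs_dnbhs_neq.
have hd : `|h| < d by near: h; exact: dnbhs0_lt.
have [Qh Q'h] : Q (w_ h) /\ Q' (w_ h).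
  split.
    by near: h; exact: w_w.
  by near: h; exact: w_w.
apply: BN => /=.
pose g (t : R) := h^-1 *: f (y + (t * h) *: w_ h).
have : B (g 1 - g 0).
  apply: mean_value => // t /andP[t0 t1].
  have [Pz Uz] : (P `&` U) (y + (t * h) *: w_ h).
    apply: (SQ (t * h, w_ h)); split=> //; apply: dS.
    rewrite /ball/= sub0r normrN normrM (ger0_norm t0).
    by rewrite (le_lt_trans _ hd)// ler_piMl.
  have Bdf : B (df (y + (t * h) *: w_ h, w_ h)) by exact: (PQ (_, _)).
  have /(_ B) := dfP _ (w_ h) Uz.
  case/(_ _); first by apply: open_nbhs_nbhs; split=> //; exact: B0o.
  move=> e /= e0 Be; exists (e / `|h|); first by rewrite /= divr_gt0 ?normr_gt0.
  move=> s /=; rewrite sub0r normrN ltr_pdivlMr ?normr_gt0// -normrM => she s0.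
  have := Be (s * h).
  rewrite /= sub0r normrN she mulf_neq0// => /(_ isT isT).
  by rewrite invfM /g mulrDl scalerDl addrA -scalerBr scalerA.
by rewrite /g mul1r mul0r scale0r addr0 -scalerBr.
Unshelve. all: by end_near. Qed.

(** With w_h the difference quotient of g, the quotient of f \o g is that of
    f along the varying direction w_h. *)
Lemma dderiv_comp V1 V W (U : set V) (g : V1 -> V) (f : V -> W) x v w z :
  hausdorff_space W -> open U -> Ck 1 U f -> U (g x) ->
  is_dderiv g x v w -> is_dderiv f (g x) w z -> is_dderiv (f \o g) x v z.
Proof.
move=> hW oU [_ [df [dfP [cdf _]]]] Ugx gw fz.
rewrite -(dderiv_unique hW (dfP _ _ Ugx) fz).
apply: cvg_trans (slope_cvg oU dfP cdf Ugx gw).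
apply: near_eq_cvg; near=> h.
have h0 : h != 0 by near: h; exact: nbhs_dnbhs_neq.
by rewrite /= scalerA divff// scale1r (addrC (g x)) subrK.
Unshelve. all: by end_near. Qed.

Lemma cvg_line V (x v : V) : (fun h : R => x + h *: v) @ 0^' --> x.
Proof.
have c1 : (fun h : R => h *: v) @ 0^' --> (0 : V).
  have c0 : (fun h : R => (h : R^o, v)) @ 0^' --> (0 : R^o, v).
    have h1 : (fun h : R => h : R^o) @ 0^' --> (0 : R^o) by exact: nbhs_dnbhs.
    have h2 : (fun=> v) @ (0 : R)^' --> v by exact: cvg_cst.
    exact: (cvg_pair h1 h2).
  have := @scale_continuous R V (0, v); rewrite /continuous_at /= scale0r.
  exact: cvg_comp c0.
have := @add_continuous V (x, 0); rewrite /continuous_at /= addr0.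
have h2 : (fun=> x) @ (0 : R)^' --> x by exact: cvg_cst.
exact: cvg_comp (cvg_pair h2 c1).
Qed.

Lemma dderiv_congr V W (U : set V) (f g : V -> W) x v w : open U -> U x ->
  {in U, f =1 g} -> is_dderiv f x v w -> is_dderiv g x v w.
Proof.
move=> oU Ux fg; apply: cvg_trans; apply: near_eq_cvg; near=> h => /=.
rewrite !fg ?inE//; near: h.
apply: (@cvg_line V x v); exact: open_nbhs_nbhs.
Unshelve. all: by end_near. Qed.

End dderiv.

(** * Calculus of C^k maps *)

Section Ck_calculus.
Context {R : realType}.
Implicit Types V W : tvsType R.

Lemma Ck_continuous k V W (U : set V) (f : V -> W) :
  Ck k U f -> {in U, continuous f}.
Proof. by case: k => [|k] []. Qed.

Lemma Ck_subset k V W (U U' : set V) (f : V -> W) :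
  U' `<=` U -> Ck k U f -> Ck k U' f.
Proof.
elim: k V U U' f => [|k IH] V U U' f UU [cf kf]; (split;
  first by move=> x /set_mem xU; apply/cf/mem_set/UU) => //.
case: kf => df [dfP kdf]; exists df; split; first by move=> x v /UU; exact: dfP.
by apply: IH kdf => -[x v] [/= /UU].
Qed.

Lemma Ck_congr k V W (U : set V) (f g : V -> W) : open U ->
  {in U, f =1 g} -> Ck k U f -> Ck k U g.
Proof.
move=> oU fg; have cg : {in U, continuous f} -> {in U, continuous g}.
  move=> cf x xU; rewrite /continuous_at -fg//.
  apply: cvg_trans (cf x xU); apply: near_eq_cvg.
  have : \forall y \near x, U y.
    by apply: open_nbhs_nbhs; split=> //; exact: set_mem.
  by apply: filterS => y /mem_set /fg.
case: k => [|k] [cf kf]; split=> //; [exact: cg|exact: cg|].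
case: kf => df [dfP kdf]; exists df; split=> // x v Ux.
exact: dderiv_congr oU Ux fg (dfP x v Ux).
Qed.

Lemma CkW k V W (U : set V) (f : V -> W) : Ck k.+1 U f -> Ck k U f.
Proof.
elim: k V U f => [|k IH] V U f [cf [df [dfP kdf]]]; split=> //.
by exists df; split=> //; exact: IH.
Qed.

Lemma continuous_comp_in V1 V W (U : set V) (g : V1 -> V) (f : V -> W) :
  continuous g -> {in U, continuous f} -> {in g @^-1` U, continuous (f \o g)}.
Proof.
move=> cg cf x xU; apply: continuous_comp; first exact: cg.
by apply: cf; rewrite inE in xU *.
Qed.

Lemma prodmap_continuous V W (L : V -> W) :
  continuous L -> continuous (prodmap L).
Proof.
move=> cL z; apply: cvg_pair.
  by apply: (@continuous_comp _ _ _ fst L); [exact: cvg_fst|exact: cL].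
by apply: (@continuous_comp _ _ _ snd L); [exact: cvg_snd|exact: cL].
Qed.

Lemma dderiv_comp_linear V1 V W (L : {linear V1 -> V}) (f : V -> W) x v w :
  is_dderiv f (L x) (L v) w -> is_dderiv (f \o L) x v w.
Proof.
apply: cvg_trans; apply: near_eq_cvg; near=> h.
by rewrite /= (linearD L) (linearZZ L).
Unshelve. all: by end_near. Qed.

(** A linear inner map makes the chain rule trivial: the derivative of f \o L is
    df \o (L x L), which is again a composition with a continuous linear map. *)
Lemma Ck_comp_linear k V1 V W (U : set V) (L : {linear V1 -> V}) (f : V -> W) :
  continuous L -> Ck k U f -> Ck k (L @^-1` U) (f \o L).
Proof.
elim: k V1 V U L f => [|k IH] V1 V U L f cL [cf kf];
  (split; first exact: continuous_comp_in) => //.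
case: kf => df [dfP kdf]; exists (df \o prodmap L); split.
  by move=> x v Ux; apply: dderiv_comp_linear; exact: dfP.
by apply: (IH _ _ (U `*` setT) (prodmap L) df) => //; exact: prodmap_continuous.
Qed.

Lemma dderiv_linear V W (L : {linear V -> W}) x v : is_dderiv L x v (L v).
Proof.
have c : (fun=> L v) @ (0 : R)^' --> L v by exact: cvg_cst.
apply: cvg_trans c; apply: near_eq_cvg; near=> h.
have h0 : h != 0 by near: h; exact: nbhs_dnbhs_neq.
by rewrite (linearD L) (linearZZ L) (addrC (L x)) addrK scalerA mulVf// scale1r.
Unshelve. all: by end_near. Qed.

Lemma Ck_linear k V W (U : set V) (L : {linear V -> W}) :
  continuous L -> Ck k U L.
Proof.
elim: k V U L => [|k IH] V U L cL; split; try by move=> ? _; exact: cL.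
  by [].
exists (L \o snd); split; first by move=> x v _; exact: dderiv_linear.
have c2 : continuous ((L : V -> W) \o @snd V V : (V * V)%type -> W).
  move=> x; apply: (@continuous_comp _ _ _ (@snd V V) (L : V -> W)).
    exact: cvg_snd.
  exact: cL.
by apply: (IH _ _ (L \o snd)).
Qed.

Lemma Ck_pair k V W1 W2 (U : set V) (f : V -> W1) (g : V -> W2) :
  Ck k U f -> Ck k U g -> Ck k U (fun x => (f x, g x)).
Proof.
elim: k V U f g => [|k IH] V U f g [cf kf] [cg kg]; (split;
  first by move=> x xU; apply: cvg_pair; [exact: cf|exact: cg]) => //.
case: kf kg => df [dfP kdf] [dg [dgP kdg]].
exists (fun z => (df z, dg z)); split; last exact: IH.
by move=> x v Ux; apply: (cvg_pair (dfP x v Ux) (dgP x v Ux)).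
Qed.

Lemma tvs_cvgD W (T : Type) (F : set_system T) {FF : Filter F}
    (f g : T -> W) (a b : W) :
  f @ F --> a -> g @ F --> b -> (fun t => f t + g t) @ F --> a + b.
Proof.
move=> fa gb.
exact: cvg_comp (cvg_pair fa gb) (@add_continuous W (a, b)).
Qed.

Lemma Ck_add k V W (U : set V) (f g : V -> W) :
  Ck k U f -> Ck k U g -> Ck k U (fun x => f x + g x).
Proof.
elim: k V U f g => [|k IH] V U f g [cf kf] [cg kg]; (split;
  first by move=> x xU; apply: tvs_cvgD; [exact: cf|exact: cg]) => //.
case: kf kg => df [dfP kdf] [dg [dgP kdg]].
exists (fun z => df z + dg z); split; last exact: IH.
move=> x v Ux; rewrite /is_dderiv.
under eq_fun do rewrite opprD addrACA scalerDr.
exact: tvs_cvgD (dfP x v Ux) (dgP x v Ux).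
Qed.

Lemma dderiv_cvg V W (f : V -> W) x v w : is_dderiv f x v w ->
  (fun h : R => f (x + h *: v)) @ 0^' --> f x.
Proof.
move=> fw.
have c1 : (fun h : R => h *: (h^-1 *: (f (x + h *: v) - f x))) @ 0^'
    --> (0 : W).
  have h1 : (fun h : R => h : R^o) @ 0^' --> (0 : R^o) by exact: nbhs_dnbhs.
  have := @scale_continuous R W (0, w); rewrite /continuous_at /= scale0r.
  exact: cvg_comp (cvg_pair h1 fw).
have c2 : (fun=> f x) @ (0 : R)^' --> f x by exact: cvg_cst.
have c3 : (fun h : R => f x + h *: (h^-1 *: (f (x + h *: v) - f x))) @ 0^'
    --> f x.
  by rewrite -[X in _ --> X]addr0; exact: tvs_cvgD.
apply: cvg_trans c3.
apply: near_eq_cvg; near=> h.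
have h0 : h != 0 by near: h; exact: nbhs_dnbhs_neq.
by rewrite scalerA divff// scale1r (addrC (f x)) subrK.
Unshelve. all: by end_near. Qed.

End Ck_calculus.

Section Ck_bilinear.
Context {R : realType} {E : normedModType R}.

Lemma L2norm_le (B : L2 E) z : `|B z| <= `|B| * (`|z| * `|z|).
Proof.
have [->|z0] := eqVneq z 0.
  by rewrite -(scale0r 0) L2ZZ mul0r !scale0r !normr0 !mulr0.
have zp : 0 < `|z| by rewrite normr_gt0.
have : `|B (`|z|^-1 *: z)| <= `|B|.
  by rewrite L2norm_ub// normrZ normfV normr_id mulVf// gt_eqF.
rewrite L2ZZ normrZ normrM !normfV !normr_id -invfM mulrC ler_pdivrMr//.
by rewrite mulr_gt0.
Qed.

(** Evaluation L2 E x (E x E) -> E is jointly continuous, since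
    |B z| <= |B| |z|^2. *)
Lemma L2_cvg (T : Type) (F : set_system T) {FF : Filter F} (B_ : T -> L2 E)
  (B : L2 E) (z_ : T -> E * E) (z : E * E) :
  B_ @ F --> B -> z_ @ F --> z -> (fun t => B_ t (z_ t)) @ F --> B z.
Proof.
move=> cB cz; have [_ _ Bc] := L2P B.
rewrite -[B z]add0r.
rewrite (_ : (fun t => B_ t (z_ t)) =
    fun t => L2fun (B_ t - B) (z_ t) + B (z_ t)); last first.
  by apply/funext => t; symmetry; exact: subrK.
apply: cvgD; last exact: cvg_comp cz (Bc z).
apply/norm_cvg0P.
have cn : (fun t => `|B_ t - B| * (`|z_ t| * `|z_ t|)) @ F --> (0 : R).
  rewrite -(mul0r (`|z| * `|z|)); apply: cvgM; last first.
    by apply: cvgM; exact: cvg_norm.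
  rewrite -(normr0 (L2 E)); apply: cvg_norm; rewrite -(subrr B).
  by apply: cvgB => //; exact: cvg_cst.
apply: squeeze_cvgr (cvg_cst 0) cn.
by apply: nearW => t; rewrite normr_ge0 L2norm_le.
Qed.

Lemma L2Dr (B : L2 E) x y y' : B (x, y + y') = B (x, y) + B (x, y').
Proof. by have [Br _ _] := L2P B; rewrite -[y]scale1r Br !scale1r. Qed.

Lemma L2Dl (B : L2 E) x x' y : B (x + x', y) = B (x, y) + B (x', y).
Proof.
by have [_ Bl _] := L2P B; have := Bl y 1 x x'; rewrite !scale1r.
Qed.

Lemma L2Br (B : L2 E) x y y' : B (x, y - y') = B (x, y) - B (x, y').
Proof. by rewrite L2Dr -scaleN1r L2Zr scaleN1r. Qed.

Lemma L2Bl (B : L2 E) x x' y : B (x - x', y) = B (x, y) - B (x', y).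
Proof. by rewrite L2Dl -scaleN1r L2Zl scaleN1r. Qed.

(** Leibniz rule: the derivative of x |-> F x (a x, b x) is a sum of three maps
    of the same form, which is what makes the induction on k go through. *)
Lemma Ck_L2 k (V : tvsType R) (U : set V) (F : V -> L2 E) (a b : V -> E) :
  Ck k U F -> Ck k U a -> Ck k U b -> Ck k U (fun x => F x (a x, b x)).
Proof.
elim: k V U F a b => [|k IH] V U F a b kF ka kb.
  split=> // x xU; apply: L2_cvg; first exact: Ck_continuous kF _ _.
  by apply: cvg_pair; [exact: Ck_continuous ka _ _|exact: Ck_continuous kb _ _].
have fstk (W : tvsType R) (f : V -> W) :
    Ck k.+1 U f -> Ck k (U `*` [set: V]) (f \o fst).
  move=> /CkW kf; apply: Ck_subset (Ck_comp_linear (L := fst) _ kf).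
    by move=> [x v] [].
  by move=> x; exact: cvg_fst.
split.
  exact: Ck_continuous (IH V U F a b (CkW kF) (CkW ka) (CkW kb)).
have FF := fstk _ _ kF; have aa := fstk _ _ ka; have bb := fstk _ _ kb.
have [cF [dF [dFP kdF]]] := kF; have [ca [da [daP kda]]] := ka.
have [cb [db [dbP kdb]]] := kb.
exists (fun z => L2fun (dF z) (a z.1, b z.1) + F z.1 (da z, b z.1)
  + F z.1 (a z.1, db z)).
split; last by apply: Ck_add; [apply: Ck_add|]; exact: IH.
move=> x v Ux.
pose xh (h : R) := x + h *: v.
pose Dq (W : tvsType R) (f : V -> W) (h : R) := h^-1 *: (f (xh h) - f x).
have ax : a \o xh @ 0^' --> a x := dderiv_cvg (daP x v Ux).
have bx : b \o xh @ 0^' --> b x := dderiv_cvg (dbP x v Ux).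
have cst (W : topologicalType) (w : W) : (fun=> w) @ (0 : R)^' --> w.
  exact: cvg_cst.
have pair (f g : R -> E) (p q : E) : f @ 0^' --> p -> g @ 0^' --> q ->
    (fun h => (f h, g h)) @ 0^' --> (p, q) by move=> fp gq; exact: cvg_pair.
have l1 := L2_cvg (dFP x v Ux : Dq _ F @ 0^' --> dF (x, v))
  (pair _ _ _ _ ax bx).
have l2 := L2_cvg (cst _ (F x)) (pair _ _ _ _ (daP x v Ux) bx).
have l3 := L2_cvg (cst _ (F x)) (pair _ _ _ _ (cst _ (a x)) (dbP x v Ux)).
have L : (fun h => L2fun (Dq _ F h) (a (xh h), b (xh h))
    + F x (Dq _ a h, b (xh h)) + F x (a x, Dq _ b h)) @ 0^'
    --> L2fun (dF (x, v)) (a x, b x) + F x (da (x, v), b x)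
      + F x (a x, db (x, v)).
  by apply: tvs_cvgD; [apply: tvs_cvgD; [exact: l1|exact: l2]|exact: l3].
apply: cvg_trans L; apply: near_eq_cvg; apply: nearW => h.
rewrite /Dq L2Zl L2Zr L2Bl L2Br.
set B := F (xh h); set a' := a (xh h); set b' := b (xh h).
have -> : L2fun (h^-1 *: (B - F x)) (a', b')
  = h^-1 *: (B (a', b') - F x (a', b')) by [].
by rewrite -!scalerDr !addrA !subrK.
Qed.

End Ck_bilinear.

(** * Closed subspaces of products *)

Section into_product_subspace.
Context {R : realType}.

Lemma open_prodset (X Y : topologicalType) (A : set X) (B : set Y) :
  open A -> open B -> open (A `*` B).
Proof.
move=> oA oB; rewrite openE => -[x y] [/= Ax By].
by exists (A, B) => //=; split; exact: open_nbhs_nbhs.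
Qed.

Lemma cvg_prod (I : eqType) (T : I -> topologicalType)
    (X : Type) (F : set_system X) {FF : Filter F}
    (f : X -> prod_topology T) (l : prod_topology T) :
  (forall i, (fun x => f x i) @ F --> l i) -> f @ F --> l.
Proof.
move=> cf; apply/cvg_sup => i B [_ [[P oP <-] /= Pl PB]].
have : F (fun x => P (f x i)) by apply: cf; exact: open_nbhs_nbhs.
by move=> FP; change (F (f @^-1` B)); apply: filterS FP => x; exact: PB.
Qed.

Section general.
Context {I : eqType} (T : I -> tvsType R) (A : submodule (prod_topology T)).

Definition scoord (u : subtvs A) (i : I) : T i := val u i.

Lemma scoord_continuous i : continuous (scoord^~ i).
Proof.
move=> u; apply: (@continuous_comp _ _ _ (val : subtvs A -> prod_topology T)
  (fun x : prod_topology T => x i)); first exact: initial_continuous.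
exact: proj_continuous.
Qed.

Lemma cvg_subtvs (X : Type) (F : set_system X) {FF : Filter F}
    (f : X -> subtvs A) (l : subtvs A) :
  (forall i, (fun x => scoord (f x) i) @ F --> scoord l i) -> f @ F --> l.
Proof.
move=> cf B [_ [[P oP <-] /= Pl PB]].
have : F (fun x => P (val (f x))).
  by apply: (@cvg_prod _ _ X F FF (val \o f) (val l) cf); exact: open_nbhs_nbhs.
by move=> FP; change (F (f @^-1` B)); apply: filterS FP => x; exact: PB.
Qed.

(** The derivatives of the components assemble into a derivative with values in
    the product; it stays in the subspace because it is a limit of difference
    quotients and the subspace is closed. This is applied to limits of model
    spaces and to H^2(F, F). *)
Lemma Ck_into_subtvs k (V : tvsType R) (U : set V) (f : V -> subtvs A) :
  closed (sub_set A) -> open U ->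
  (forall i, Ck k U (fun x => scoord (f x) i)) ->
  Ck k U f.
Proof.
move=> clA; elim: k V U f => [|k IH] V U f oU kf; split=> //.
- by move=> x xU; apply: cvg_subtvs => i; exact: Ck_continuous (kf i) x xU.
- by move=> x xU; apply: cvg_subtvs => i; exact: Ck_continuous (kf i) x xU.
pose df i := projT1 (cid (proj2 (kf i))).
have dfP i : (forall x v, U x ->
      is_dderiv (fun x => scoord (f x) i) x v (df i (x, v))) /\
    Ck k (U `*` setT) (df i) by exact: projT2 (cid (proj2 (kf i))).
(* the default 0 is only reached above points outside U *)
pose d (z : V * V) : subtvs A := insubd (0 : subtvs A) (fun i => df i z).
have dE z : U z.1 -> val (d z) = fun i => df i z.
  move=> Uz; rewrite val_insubd ifT//; apply/mem_set.
  pose s (h : R) := h^-1 *: (f (z.1 + h *: z.2) - f z.1).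
  apply: (@closed_cvg _ _ (0 : R)^' _ (val \o s) _ clA).
    by apply: nearW => h; have /set_mem := valP (s h).
  by apply: cvg_prod => i; case: z Uz @s => x v Ux s; exact: (proj1 (dfP i)).
exists d; split.
  move=> x v Ux; apply: cvg_subtvs => i.
  by rewrite /scoord dE//; exact: (proj1 (dfP i)).
apply: IH => [|i]; first by apply: open_prodset => //; exact: openT.
apply: Ck_congr (proj2 (dfP i)).
  by apply: open_prodset => //; exact: openT.
by move=> z; rewrite inE => -[Uz _]; rewrite /scoord dE.
Qed.

End general.

Lemma closed_eqfun (X Y : topologicalType) (f g : X -> Y) : hausdorff_space Y ->
  continuous f -> continuous g -> closed [set x | f x = g x].
Proof.
move=> hY cf cg x clx; apply: hY => P Q Pf Qg.
have /clx [y [/= fg [Py Qy]]] : nbhs x (f @^-1` P `&` g @^-1` Q).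
  by apply: filterI; [exact: cf|exact: cg].
by exists (f y); split=> //; rewrite fg.
Qed.

End into_product_subspace.

(** * Atlases and tangent bundles *)

Section atlases.
Context {R : realType}.
Implicit Types V W : tvsType R.

(** What the construction of the tangent bundle needs and preserves. Maximality
    is left out: the charts induced on the tangent bundle need not form a
    maximal atlas. *)
Definition good_atlas V (N : premanifold V) : Prop :=
  (forall c, atlas (p := N) c -> is_chart c) /\
  (forall c d, atlas (p := N) c -> atlas d -> compatible c d).

Lemma local_repE V W (N : premanifold V) (P : premanifold W)
    (c : chart N V) (d : chart P W) (f : N -> P) m n :
  is_chart c -> dom c n -> local_rep c d f m (c n) = d (f n).
Proof.
move=> [ci _] cn; rewrite /local_rep /=.
by rewrite (pinvKV _ ci (mem_set cn)).
Qed.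

(** A map G that reads in the chart d' the same points that g reads in d is
    locally the transition map after g, so the chain rule gives its derivative.
    The agreement of G with d' is only asked over [dom d]: the values of d'
    outside [dom d'] are those of the transition map as well. *)
Lemma dderiv_change_chart V W (P : premanifold W) (d d' : chart P W) (p : P)
    (U : set V) (g G : V -> W) x v w z :
  hausdorff_space W -> good_atlas P -> atlas d -> atlas d' ->
  dom d p -> dom d' p -> open U -> U x -> g x = d p ->
  (forall y, U y -> exists2 n, dom d n & g y = d n /\ G y = d' n) ->
  is_dderiv g x v w -> is_dderiv (local_rep d d' idfun p) (d p) w z ->
  is_dderiv G x v z.
Proof.
move=> hW [Pc Pcompat] ad ad' dp d'p oU Ux gx gG gw tz.
have [_ /(_ p (conj dp d'p))[oD Dk]] := Pcompat _ _ ad ad'.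
have Dgx : (d @` (dom d `&` dom d')) (g x) by rewrite gx; exists p.
rewrite -gx in tz.
apply: dderiv_congr oU Ux _ (dderiv_comp hW oD (Dk 1%N) Dgx gw tz).
move=> y /set_mem/gG[n dn [gy Gy]].
by rewrite /= gy Gy local_repE//; exact: Pc.
Qed.

Lemma transition_comp V (N : premanifold V) (c d e : chart N V) m w a b :
  hausdorff_space V -> good_atlas N -> atlas c -> atlas d -> atlas e ->
  dom c m -> dom d m -> dom e m ->
  is_dderiv (local_rep c d idfun m) (c m) w a ->
  is_dderiv (local_rep d e idfun m) (d m) a b ->
  is_dderiv (local_rep c e idfun m) (c m) w b.
Proof.
move=> hV gN ac ad ae cm dm em wa.
have [Nc /(_ _ _ ac ad)[oU _]] := gN.
apply: (dderiv_change_chart hV gN ad ae dm em oU _ _ _ wa).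
- by exists m.
- by rewrite local_repE//; exact: Nc.
- move=> _ [n [cn dn] <-]; exists n => //.
  by rewrite !local_repE//; exact: Nc.
Qed.

Lemma tangent_ext V (N : premanifold V) (u u' : tangent N) c :
  hausdorff_space V -> atlas c -> dom c (base u) -> base u' = base u ->
  rep u c = rep u' c -> u = u'.
Proof.
case: u u' => [m r off coh] [m' r' off' coh'] /= hV ac cm e rr.
case: _ / (esym e) off' coh' => off' coh'.
suff rE : r = r'.
  case: _ / rE off' coh' => off' coh'.
  by congr Tangent; exact: Prop_irrelevance.
apply/funext => d; have [[ad dm]|nd] := pselect (atlas d /\ dom d m).
  apply: (dderiv_unique hV (coh c d ac cm ad dm)).
  by rewrite rr; exact: coh'.
by rewrite off// off'.
Qed.

(** The other representatives are forced to be the derivatives of the transition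
    maps out of c, and the chain rule for transition maps is their coherence.
    This makes the charts of the tangent bundle surjective onto U x V. *)
Lemma tangent_exists V (N : premanifold V) (c : chart N V) m w :
  hausdorff_space V -> good_atlas N -> atlas c -> dom c m ->
  exists2 u : tangent N, base u = m & rep u c = w.
Proof.
move=> hV gN ac cm; have [Nc Ncompat] := gN.
have tr d e : atlas d -> dom d m -> atlas e -> dom e m -> forall a,
    exists b, is_dderiv (local_rep d e idfun m) (d m) a b.
  move=> ad dm ae em a.
  have [_ /(_ m (conj dm em))[_ /(_ 1%N)[_ [df [dfP _]]]]] := Ncompat _ _ ad ae.
  by exists (df (d m, a)); apply: dfP; exists m.
(* representatives in the charts around m; the normalized value 0 elsewhere *)
pose r d := if pselect (atlas d /\ dom d m) then
  xget 0 [set b | is_dderiv (local_rep c d idfun m) (c m) w b] else 0.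
have rP d : atlas d -> dom d m ->
    is_dderiv (local_rep c d idfun m) (c m) w (r d).
  move=> ad dm; rewrite /r; case: pselect => [?|[]//].
  exact: xgetPex (tr _ _ ac cm ad dm w).
have off d : ~ (atlas d /\ dom d m) -> r d = 0 by rewrite /r; case: pselect.
have coh d e : atlas d -> dom d m -> atlas e -> dom e m ->
    is_dderiv (local_rep d e idfun m) (d m) (r d) (r e).
  move=> ad dm ae em; have [z rz] := tr _ _ ad dm ae em (r d).
  have cz := transition_comp hV gN ac ad ae cm dm em (rP _ ad dm) rz.
  by rewrite (dderiv_unique hV (rP _ ae em) cz).
exists (Tangent off coh) => //=.
apply: (dderiv_unique hV (rP _ ac cm)).
have [_ oc] := Nc _ ac.
apply: (dderiv_congr oc (f := idfun)); first by exists m.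
  by move=> _ /set_mem [n cn <-]; rewrite local_repE//; exact: Nc.
exact: (@dderiv_linear _ _ _ idfun).
Qed.

Lemma tmap_base V W (N : premanifold V) (P : premanifold W) (f : N -> P)
  (v : tbundle N) : base (tmap f v : tangent P) = f (base v).
Proof. by rewrite /tmap; case: xgetP => [w _ []|]. Qed.

(** The tangent map is a choice among the vectors satisfying [is_tmap], so its
    value is obtained by showing that w satisfies it, in all pairs of charts by
    the chain rule from the pair (c, d), and that such a vector is unique. *)
Lemma tmap_linear_rep V W (N : premanifold V) (P : premanifold W) (f : N -> P)
    (c : chart N V) (d : chart P W) (L : {linear V -> W})
    (v : tangent N) (w : tangent P) :
  hausdorff_space V -> hausdorff_space W -> good_atlas N -> good_atlas P ->
  continuous L -> atlas c -> atlas d -> f @` dom c `<=` dom d ->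
  (forall n, dom c n -> d (f n) = L (c n)) ->
  dom c (base v) -> base w = f (base v) -> rep w d = L (rep v c) ->
  tmap f (v : tbundle N) = w.
Proof.
move=> hV hW gN gP cL ac ad fcd dfL cv bw rw.
have dw : dom d (base w) by rewrite bw; apply: fcd; exists (base v).
have fw : is_tmap f v w.
  split=> // c' d' ac' c'v ad' d'w.
  have [Nc /(_ _ _ ac' ac)[oU _]] := gN.
  have Lc := dderiv_comp hW (@openT V) (Ck_linear 1 setT cL) I
    (rep_coh ac' c'v ac cv) (@dderiv_linear _ _ _ L _ _).
  rewrite -rw in Lc.
  apply: (dderiv_change_chart hW gP ad ad' dw d'w oU _ _ _ Lc).
  - by exists (base v).
  - by rewrite /= local_repE ?bw ?dfL//; exact: Nc.
  - move=> _ [n [c'n cn] <-]; exists (f n); first by apply: fcd; exists n.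
    by rewrite /= !local_repE ?dfL//; exact: Nc.
  - exact: rep_coh.
rewrite /tmap; case: xgetP => [w' -> [bw' fw']|/(_ w)//].
apply: (@tangent_ext _ _ _ _ d) => //; first by rewrite bw' -bw.
  by rewrite bw.
apply: (dderiv_unique hW (fw' c d ac cv ad _)); first by rewrite bw' -bw.
exact: (proj2 fw).
Qed.

Lemma tchart_image V (N : premanifold V) (c : chart N V) (D : set N) :
  hausdorff_space V -> good_atlas N -> atlas c -> D `<=` dom c ->
  tchart c @` (@base R V N @^-1` D) = (c @` D) `*` setT.
Proof.
move=> hV gN ac Dc; apply/seteqP; split => [_ [u Du <-]|[x w] [/= [m Dm <-] _]].
  by split=> //; exists (base u).
have [u bu ru] := tangent_exists w hV gN ac (Dc _ Dm).
by exists u; rewrite /= ?bu ?ru.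
Qed.

(** The transition maps of the tangent bundle are (x, w) |-> (t x, dt (x, w))
    with t a transition map of N. *)
Lemma good_tbundle V (N : premanifold V) :
  hausdorff_space V -> good_atlas N -> good_atlas (tbundle N).
Proof.
move=> hV gN; have [Nc Ncompat] := gN.
have tc c : atlas (p := N) c -> is_chart (N := tbundle N) (tchart c).
  move=> ac; have [ci co] := Nc _ ac; split.
    move=> u u' /set_mem /= cu /set_mem /= cu' [e r].
    by apply: (tangent_ext hV ac) => //; apply: ci; rewrite ?inE.
  rewrite (@tchart_image _ _ c (dom c))//.
  by apply: open_prodset => //; exact: openT.
split; first by move=> _ [c ac <-]; exact: tc.
move=> _ _ [c ac <-] [d ad <-].
have [oU Uk] := Ncompat _ _ ac ad.
have imE : tchart c @` (dom (tchart c) `&` dom (tchart d)) =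
    (c @` (dom c `&` dom d)) `*` setT.
  by rewrite -(@tchart_image _ _ c (dom c `&` dom d))// => n [].
have oT : open ((c @` (dom c `&` dom d)) `*` [set: V]).
  by apply: open_prodset => //; exact: openT.
split; first by rewrite imE.
move=> u [/= cu du]; rewrite imE; split=> // k.
have [_ /(_ k.+1) tk] := Uk _ (conj cu du).
have [_ [df [dfP kdf]]] := tk.
apply: (@Ck_congr _ _ _ _ _
  (fun z => (local_rep c d idfun (base u) z.1, df z))) => //.
  move=> z /set_mem; rewrite -imE => -[w [cw dw] <-].
  rewrite (@local_repE _ _ (tbundle N) (tbundle N) (tchart c))//; last first.
    exact: tc.
  rewrite /= local_repE//; last exact: Nc.
  congr (_, _); apply: (dderiv_unique hV (dfP _ _ _)); first by exists (base w).
  apply: dderiv_congr oU _ _ (rep_coh ac cw ad dw); first by exists (base w).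
  by move=> _ /set_mem[n [cn dn] <-]; rewrite !local_repE//; exact: Nc.
apply: Ck_pair => //.
apply: Ck_subset (Ck_comp_linear (L := @fst V V) _ (CkW tk)).
  by move=> z [].
by move=> z; exact: cvg_fst.
Qed.

End atlases.

(** * The manifold topology *)

Section manifold_topology.
Context {R : realType}.
Implicit Types V W : tvsType R.

Lemma open_chart_preimage V (N : premanifold V) (c : chart N V) (P : set V) :
  atlas c -> open P -> open (dom c `&` c @^-1` P : set N).
Proof.
move=> ac oP; exists [set dom c `&` c @^-1` P]; last by rewrite bigcup_set1.
move=> _ ->; apply: (@finI_from1 _ _ _ idfun (dom c `&` c @^-1` P)) => /=.
by exists c, P.
Qed.

Lemma continuous_into_premanifold (X : topologicalType) V (N : premanifold V)
    (f : X -> N) :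
  (forall c P, atlas c -> open P -> open (f @^-1` (dom c `&` c @^-1` P))) ->
  continuous f.
Proof.
move=> fc; apply/continuousP => _ [D sD <-].
rewrite preimage_bigcup; apply: bigcup_open => _ /sD [B' B'sub <-].
rewrite preimage_bigcap openE => x fx; apply: filter_bigI => B BB'.
apply: open_nbhs_nbhs; split; last exact: fx.
by have /set_mem [c [P [ac oP ->]]] := B'sub _ BB'; exact: fc.
Qed.

Lemma base_continuous V (N : premanifold V) :
  continuous (@base R V N : tbundle N -> N).
Proof.
apply: continuous_into_premanifold => c P ac oP.
have := @open_chart_preimage _ (tbundle N) (tchart c) (P `*` setT) _ _.
move=> /(_ (ex_intro2 _ _ c ac erefl)).
move=> /(_ (open_prodset oP (@openT V))).
congr open; apply/seteqP; split=> [v [/= cv [Bv _]]//|v [cv Bv]].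
by split=> //; split.
Qed.

End manifold_topology.

(** * Projective limits and their tangent bundles *)

Section systems.
Context {R : realType}.
Implicit Types S : psystem R.

(** The hypotheses on a system that pass to the system of tangent bundles, so
    that what is proved for TM = lim TM_i also holds for TTM = lim TTM_i. *)
Definition good_system S : Prop :=
  [/\ forall i, hausdorff_space (space S i),
      forall i j (h : (i <= j)%N), continuous (bond S h) &
      forall i, good_atlas (man S i)].

Lemma hausdorff_pair (V W : topologicalType) :
  hausdorff_space V -> hausdorff_space W -> hausdorff_space (V * W)%type.
Proof.
move=> hV hW [x y] [x' y'] cl; congr (_, _).
  apply: hV => A B Ax Bx.
  have [p [Ap Bp]] := cl (fst @^-1` A) (fst @^-1` B)
    (@cvg_fst _ _ (nbhs x) (nbhs y) _ _ Ax)
    (@cvg_fst _ _ (nbhs x') (nbhs y') _ _ Bx).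
  by exists p.1.
apply: hW => A B Ay By.
have [p [Ap Bp]] := cl (snd @^-1` A) (snd @^-1` B)
  (@cvg_snd _ _ (nbhs x) (nbhs y) _ _ Ay)
  (@cvg_snd _ _ (nbhs x') (nbhs y') _ _ By).
by exists p.2.
Qed.

Lemma good_tsystem S : good_system S -> good_system (tsystem S).
Proof.
move=> [hS cS aS]; split=> [i|i j h|i]; first exact: hausdorff_pair.
  exact/prodmap_continuous/cS.
exact: good_tbundle.
Qed.

Lemma lim_space_ext S (u u' : lim_space S) :
  (forall i, coord u i = coord u' i) -> u = u'.
Proof. by move=> uu; apply: val_inj; exact: functional_extensionality_dep. Qed.

Lemma lim_space_thread S (u : lim_space S) i j (h : (i <= j)%N) :
  bond S h (coord u j) = coord u i.
Proof. by have /set_mem := valP u; exact. Qed.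

Lemma lim_point_thread S (m : lim_point S) i j (h : (i <= j)%N) :
  link S h (proj_point m j) = proj_point m i.
Proof. by have /set_mem := valP m; exact. Qed.

Lemma proj_point_continuous S i :
  continuous (fun m : lim_point S => proj_point m i).
Proof.
move=> m; apply: (@continuous_comp _ _ _ (set_val : lim_point S -> _)
  (fun x : prod_topology (fun i => man S i) => x i)).
  exact: initial_continuous.
exact: proj_continuous.
Qed.

Lemma continuous_into_lim_point (X : topologicalType) S (f : X -> lim_point S) :
  (forall i, continuous (fun x => proj_point (f x) i)) -> continuous f.
Proof.
move=> fc; apply: (@continuous_comp_initial _ _ _ set_val f) => x.
apply: (@cvg_prod _ (fun i => man S i) _ (nbhs x) (nbhs_filter x)) => i.
exact: fc.
Qed.

Lemma coord_continuous S i : continuous (fun u : lim_space S => coord u i).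
Proof. exact: scoord_continuous. Qed.

Lemma continuous_into_lim_space (X : topologicalType) S (f : X -> lim_space S) :
  (forall i, continuous (fun x => coord (f x) i)) -> continuous f.
Proof.
move=> fc x; apply: (@cvg_subtvs _ _ _ _ _ (nbhs x) (nbhs_filter x)) => i.
exact: fc.
Qed.

Lemma lim_space_exists S (x : forall i, space S i) :
  (forall i j (h : (i <= j)%N), bond S h (x j) = x i) ->
  exists u : lim_space S, forall i, coord u i = x i.
Proof. by move=> tx; exists (exist _ (x : prod_topology _) (mem_set tx)). Qed.

Lemma lim_point_exists S (x : forall i, man S i) :
  (forall i j (h : (i <= j)%N), link S h (x j) = x i) ->
  exists m : lim_point S, forall i, proj_point m i = x i.
Proof. by move=> tx; exists (exist _ (x : prod_topology _) (mem_set tx)). Qed.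

Lemma lim_chartE S (c : forall i, chart (man S i) (space S i)) m i :
  (forall i j (h : (i <= j)%N) n, dom (c j) n ->
    c i (link S h n) = bond S h (c j n)) ->
  dom (lim_chart c) m -> coord (lim_chart c m) i = c i (proj_point m i).
Proof.
move=> cb cm.
have [u uP] : exists u : lim_space S,
    forall i, coord u i = c i (proj_point m i).
  by apply: lim_space_exists => j k h; rewrite -cb ?lim_point_thread.
exact: (xgetPex (0 : lim_space S) (ex_intro
  [set u : lim_space S | forall i, coord u i = c i (proj_point m i)] u uP)).
Qed.

Definition tlim_charts S (c : forall i, chart (man S i) (space S i)) :
  forall i, chart (man (tsystem S) i) (space (tsystem S) i) :=
  fun i => tchart (c i).

Lemma base_thread S (v : lim_point (tsystem S)) :
  exists m : lim_point S, forall i, proj_point m i = base (proj_point v i).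
Proof.
apply: lim_point_exists => i j h.
by rewrite -(@lim_point_thread _ v i j h) tmap_base.
Qed.

Lemma tmap_lim_chart S (c : forall i, chart (man S i) (space S i)) i j
    (h : (i <= j)%N) (v : tangent (man S j)) (w : tangent (man S i)) :
  good_system S -> plim_charts c -> dom (c j) (base v) ->
  base w = link S h (base v) -> rep w (c i) = bond S h (rep v (c j)) ->
  tmap (link S h) (v : tbundle (man S j)) = w.
Proof.
move=> [hS cS aS] [ac lc bc _ _] cv bw rw.
by apply: (tmap_linear_rep _ _ _ _ (cS i j h) (ac j) (ac i)) => //; exact: bc.
Qed.

(** The domain of the limit of the charts of the TM_i is the preimage of U under
    TM -> M, and its image the preimage of phi(U) under the first projection
    lim (E_i x E_i) -> lim E_i; both projections are continuous. Any thread over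
    phi(U) is reached, since tangent vectors with prescribed representatives
    exist and the connecting maps act on representatives by those of the E_i. *)
Lemma plim_tcharts S (c : forall i, chart (man S i) (space S i)) :
  good_system S -> plim_charts c -> plim_charts (tlim_charts c).
Proof.
move=> gS pc; have [hS cS aS] := gS; have [ac lc bc oD oI] := pc.
have tb i j (h : (i <= j)%N) v : dom (tlim_charts c j) v ->
    tlim_charts c i (link (tsystem S) h v) =
    bond (tsystem S) h (tlim_charts c j v).
  move=> cv; have cw : dom (c i) (link S h (base v)).
    by apply: (lc _ _ h); exists (base v).
  have [w bw rw] :=
    tangent_exists (bond S h (rep v (c j))) (hS i) (aS i) (ac i) cw.
  by rewrite [link _ _ _](tmap_lim_chart (v := v) (w := w) gS pc)// /= bw rw bc.
split.
- by move=> i; exists (c i).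
- move=> i j h _ [v cv <-].
  by rewrite /= tmap_base; apply: (lc _ _ h); exists (base v).
- exact: tb.
- pose pi (v : lim_point (tsystem S)) := projT1 (cid (base_thread v)).
  have piE v i : proj_point (pi v) i = base (proj_point v i).
    exact: (projT2 (cid (base_thread v))).
  have pic : continuous pi.
    apply: continuous_into_lim_point => i.
    rewrite (_ : (fun v => _) =
      (@base R _ (man S i) : man (tsystem S) i -> _) \o
      (fun v => proj_point v i)); last by apply/funext => v; exact: piE.
    move=> v; apply: continuous_comp; first exact: proj_point_continuous.
    exact: base_continuous.
  rewrite (_ : dom _ = pi @^-1` dom (lim_chart c)).
    by apply: open_comp => // v _; exact: pic.
  by apply/seteqP; split=> v cv i; have := cv i; rewrite /= piE.
- have qP (u : lim_space (tsystem S)) :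
      exists x : lim_space S, forall i, coord x i = (coord u i).1.
    by apply: lim_space_exists => i j h; rewrite -(lim_space_thread u h).
  pose q u := projT1 (cid (qP u)).
  have qE u i : coord (q u) i = (coord u i).1 by exact: (projT2 (cid (qP u))).
  have qc : continuous q.
    apply: continuous_into_lim_space => i.
    rewrite (_ : (fun u => _) = @fst (space S i) (space S i) \o
      (fun u : lim_space (tsystem S) => coord u i)); last first.
      by apply/funext => u; exact: qE.
    move=> u; apply: continuous_comp; first exact: coord_continuous.
    exact: cvg_fst.
  rewrite (_ : _ @` _ = q @^-1` (lim_chart c @` dom (lim_chart c))).
    by apply: open_comp => // u _; exact: qc.
  apply/seteqP; split=> [_ [v cv <-]|u [m cm mu]].
    have [m mP] := base_thread v.
    have cm : dom (lim_chart c) m by move=> i; rewrite mP; exact: cv.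
    exists m => //; apply: lim_space_ext => i.
    by rewrite qE !lim_chartE// mP.
  have vP i : exists v : tangent (man S i),
      base v = proj_point m i /\ rep v (c i) = (coord u i).2.
    have [v bv rv] := tangent_exists (coord u i).2 (hS i) (aS i) (ac i) (cm i).
    by exists v.
  pose v i := projT1 (cid (vP i)).
  have bv i : base (v i) = proj_point m i by exact: (projT2 (cid (vP i))).1.
  have rv i : rep (v i) (c i) = (coord u i).2 by exact: (projT2 (cid (vP i))).2.
  have [V VP] : exists V : lim_point (tsystem S),
      forall i, proj_point V i = v i.
    apply: lim_point_exists => i j h; apply: (tmap_lim_chart gS pc).
    - by rewrite bv; exact: cm.
    - by rewrite !bv lim_point_thread.
    - by rewrite !rv -(lim_space_thread u h).
  have cV : dom (lim_chart (tlim_charts c)) V.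
    by move=> i; rewrite VP /= bv; exact: cm.
  exists V => //; apply: lim_space_ext => i.
  rewrite lim_chartE// VP /= bv rv [RHS]surjective_pairing -qE -mu.
  by rewrite lim_chartE.
Qed.

Lemma lim_chart_is_chart S (c : forall i, chart (man S i) (space S i)) :
  good_system S -> plim_charts c -> is_chart (N := plim S) (lim_chart c).
Proof.
move=> [_ _ aS] [ac _ bc _ oI]; split=> // m m' /set_mem cm /set_mem cm' cmm.
apply: val_inj; apply: functional_extensionality_dep => i.
have [/(_ _ (ac i))[ci _] _] := aS i.
apply: ci; [exact/mem_set/cm|exact/mem_set/cm'|].
by rewrite -!lim_chartE// cmm.
Qed.

Lemma threads_topclosed S : good_system S ->
  closed (threads (fun i j h => bond S h) : set (prod_topology (space S))).
Proof.
move=> [hS cS _] x clx i j h.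
have : closed [set x : prod_topology (space S) | bond S h (x j) = x i].
  apply: closed_eqfun; first exact: hS.
    move=> y; apply: (@continuous_comp _ _ _
      (fun x : prod_topology (space S) => x j)).
      exact: proj_continuous.
    exact: cS.
  exact: proj_continuous.
by apply; apply: closureS clx => y; exact.
Qed.

Lemma coord_linear S i : linear (fun u : lim_space S => coord u i).
Proof. by move=> a u v. Qed.

Definition coordL S i (u : lim_space S) : space S i := coord u i.
HB.instance Definition _ S i :=
  GRing.isLinear.Build R (lim_space S) (space S i) *:%R (@coordL S i)
    (@coord_linear S i).

End systems.

(** * Limits of sprays *)

Section spray_rep.
Context {R : realType} {V : normedModType R}.

(** The full local representative of a spray, of which the second component is
    the principal part. *)
Definition spray_rep (Gamma : V -> L2 V) (z : V * V) : (V * V) * (V * V) :=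
  (z, (z.2, Gamma z.1 (z.2, z.2))).

Lemma Ck_spray_rep k (U : set V) (Gamma : V -> L2 V) :
  Ck k U Gamma -> Ck k (U `*` setT) (spray_rep Gamma).
Proof.
move=> kG.
have k2 : Ck k (U `*` setT) (@snd V V).
  by apply: (Ck_linear _ _ (L := @snd V V)) => z; exact: cvg_snd.
apply: Ck_pair.
  by apply: (Ck_linear _ _ (L := idfun)) => z; exact: cvg_id.
apply: Ck_pair => //.
apply: (Ck_L2 (F := Gamma \o fst)) => //.
apply: Ck_subset (Ck_comp_linear (L := @fst V V) _ kG); first by move=> z [].
by move=> z; exact: cvg_fst.
Qed.

End spray_rep.

Section H2_closedness.
Context {R : realType} {E : nat -> normedModType R}.
Variable rho : forall i j, (i <= j)%N -> {linear E j -> E i}.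

Lemma H2_topclosed : (forall i j (h : (i <= j)%N), continuous (rho h)) ->
  closed (H2_threads rho).
Proof.
move=> crho B clB i j h x y.
have ev k z :
  continuous (fun B : prod_topology (fun i => L2 (E i)) => L2fun (B k) z).
  move=> B'; apply: (@L2_cvg _ _ _ (nbhs B') (nbhs_filter B') (fun B => B k)).
    exact: (@proj_continuous nat (fun i => L2 (E i)) k).
  exact: cvg_cst.
have : closed [set B : prod_topology (fun i => L2 (E i)) |
    L2fun (B i) (rho h x, rho h y) = rho h (L2fun (B j) (x, y))].
  apply: closed_eqfun; [exact: norm_hausdorff|exact: ev|].
  move=> B'; apply: (@continuous_comp _ _ _
    (fun B : prod_topology (fun i => L2 (E i)) => L2fun (B j) (x, y))).
    exact: ev.
  exact: crho.
by apply; apply: closureS clB => B'; exact.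
Qed.

End H2_closedness.

Theorem theorem4p2 (R : realType) (E : nat -> completeNormedModType R)
    (rho : forall i j, (i <= j)%N -> {linear E j -> E i})
    (M : forall i, premanifold (E i))
    (phi : forall i j, (i <= j)%N -> M j -> M i)
    (zeta : forall i, tbundle (M i) -> tbundle (tbundle (M i)))
    (S := @PSystem R E rho M phi) :
  functorial rho -> (forall i j (h : (i <= j)%N), continuous (rho i j h)) ->
  (forall i, is_manifold (M i)) ->
  functorial phi -> (forall i j (h : (i <= j)%N), smooth_map (phi i j h)) ->
  (forall m : lim_point S,
     exists2 c, plim_charts (S := S) c & dom (lim_chart (S := S) c) m) ->
  (forall i, is_spray (zeta i)) ->
  projective_sprays rho phi zeta ->
  exists zeta_lim : plim (tsystem S) -> plim (tsystem (tsystem S)),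
    (forall v i, proj_point (zeta_lim v) i = zeta i (proj_point v i)) /\
    is_limit_spray zeta_lim.
Proof.
move=> _ crho manM _ _ cover sprayz projz.
have gS : good_system S.
  split=> [i|i j h|i]; [exact: norm_hausdorff|exact: crho|].
  by case: (manM i).
have gT := good_tsystem gS; have gTT := good_tsystem gT.
have zbase i (v : tbundle (M i)) : base (zeta i v) = v.
  by have [[[_ zb] _] _] := sprayz i; exact: zb.
have local c : plim_charts (S := S) c ->
    exists Gamma : forall i, E i -> L2 (E i),
    forall i, local_spray (zeta i) (c i) (Gamma i).
  move=> [ac _ _ _ _].
  have G i : exists Gamma, local_spray (zeta i) (c i) Gamma.
    by have [_ zc] := sprayz i; apply: zc; exact: ac.
  by exists (fun i => projT1 (cid (G i))) => i; exact: projT2 (cid (G i)).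
(* Around m, T phi_ji is represented by rho x rho, whose derivative maps
   (v_j, Gamma_j(v_j, v_j)) to (v_i, Gamma_i(v_i, v_i)). *)
have thread (v : lim_point (tsystem S)) i j (h : (i <= j)%N) :
    link (tsystem (tsystem S)) h (zeta j (proj_point v j)) =
    zeta i (proj_point v i).
  have [m mv] := base_thread v; have [c pc cm] := cover m.
  have [Gamma GP] := local c pc.
  have cv k : dom (c k) (base (proj_point v k)) by rewrite -mv; exact: cm.
  have [_ _ bc _ _] := pc; have [_ _ tbc _ _] := plim_tcharts gS pc.
  have vE : rep (proj_point v i) (c i) = rho i j h (rep (proj_point v j) (c j)).
    have := tbc i j h _ (cv j); rewrite lim_point_thread.
    by move=> /(congr1 snd).
  have bE : c i (base (proj_point v i)) =
      rho i j h (c j (base (proj_point v j))).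
    by rewrite -!mv -(lim_point_thread m h) (bc i j h)// mv; exact: cv.
  apply: (tmap_lim_chart gT (plim_tcharts gS pc)).
  - by rewrite zbase; exact: cv.
  - by rewrite !zbase lim_point_thread.
  - have [_ _ repi] := GP i; have [_ _ repj] := GP j.
    apply: (etrans (repi _ (cv i))).
    apply: (etrans _ (congr1 (bond (tsystem S) h) (esym (repj _ (cv j))))).
    rewrite vE bE; congr (_, _); symmetry; apply: (projz c Gamma) => //.
    by exists (base (proj_point v j)).
have limP v := lim_point_exists (thread v).
pose zl (v : plim (tsystem S)) : plim (tsystem (tsystem S)) :=
  projT1 (cid (limP v)).
have zlE v i : proj_point (zl v) i = zeta i (proj_point v i).
  exact: (projT2 (cid (limP v))).
exists zl; split=> //; split.
- move=> v; have [m mv] := base_thread v; have [c pc cm] := cover m.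
  have [Gamma GP] := local c pc.
  have tpc := plim_tcharts gS pc; have ttpc := plim_tcharts gT tpc.
  have [_ _ tbc _ oI] := tpc; have [_ _ ttbc _ _] := ttpc.
  exists (lim_chart (tlim_charts c)), (lim_chart (tlim_charts (tlim_charts c))).
  split.
  + by exists (tlim_charts c).
  + by exists (tlim_charts (tlim_charts c)).
  + by move=> i; rewrite /= -mv; exact: cm.
  + by move=> _ [w cw <-] i; rewrite zlE /= zbase; exact: cw.
  + split=> // k; apply: Ck_into_subtvs => // [|i].
      exact: (threads_topclosed gTT).
    have [[_ Gk] _ repi] := GP i.
    have kG := Ck_comp_linear (L := @coordL _ (tsystem S) i)
      (@coord_continuous _ (tsystem S) i) (Ck_spray_rep (Gk k)).
    apply: (Ck_congr (f := spray_rep (Gamma i) \o @coordL _ (tsystem S) i)) =>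
      //.
      move=> _ /set_mem[w cw <-].
      have cz : dom (lim_chart (tlim_charts (tlim_charts c))) (zl w).
        by move=> j; rewrite zlE /= zbase; exact: cw.
      rewrite local_repE//; last exact: (lim_chart_is_chart gT tpc).
      rewrite [RHS](lim_chartE i ttbc cz) zlE /= /coordL (lim_chartE i tbc cw).
      by rewrite /spray_rep /= zbase repi//; exact: cw.
    apply: Ck_subset kG => _ [w cw <-].
    rewrite /= /coordL (lim_chartE i tbc cw); split=> //=.
    by exists (base (proj_point w i)) => //; exact: cw.
- by move=> v i; rewrite zlE zbase.
- by move=> v i; rewrite zlE; have [[_ zs] _] := sprayz i; exact: zs.
- move=> c pc; have [Gamma GP] := local c pc.
  have [_ _ bc _ oI] := pc.
  have cU u i : (lim_chart (S := S) c @` dom (lim_chart c)) u ->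
      (c i @` dom (c i)) (coord u i).
    move=> [m cm <-]; rewrite (lim_chartE i bc cm).
    by exists (proj_point m i) => //; exact: cm.
  (* outside phi(U) the sequence need not lie in H^2; 0 is the default *)
  pose G (u : lim_space S) : H2 rho :=
    insubd (0 : H2 rho) (fun i => Gamma i (coord u i)).
  have GE u i : (lim_chart (S := S) c @` dom (lim_chart c)) u ->
      H2coord (G u) i = Gamma i (coord u i).
    move=> cu; rewrite /H2coord val_insubd ifT//; apply/mem_set => j k h x y.
    rewrite (projz c Gamma pc GP _ _ h)//.
      by rewrite (lim_space_thread u h).
    exact: cU.
  exists G; split.
  + split=> // k; apply: Ck_into_subtvs => // [|i]; first exact: H2_topclosed.
    have [[_ Gk] _ _] := GP i.
    have kG := Ck_comp_linear (L := @coordL _ S i)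
      (@coord_continuous _ S i) (Gk k).
    apply: (Ck_congr (f := Gamma i \o @coordL _ S i)) => //.
      by move=> u /set_mem cu; rewrite /scoord -/(H2coord _ _) GE.
    by apply: Ck_subset kG => u /(cU _ i).
  + exists Gamma; split=> [i|u cu i]; last exact: GE.
    by have [] := GP i.
  + move=> u cu i; rewrite GE//; have [_ sym _] := GP i; apply: sym.
    exact: cU.
  + move=> m v mv cm i; have [_ _ repi] := GP i.
    rewrite zlE repi ?mv; last exact: cm.
    by rewrite GE ?(lim_chartE i bc cm)//; exists m.
Qed.
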